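(* For each $\varepsilon>0$, there exist $\delta,C>0$ such that, if $p\geq C/n$, then $G=G(n,p)$ has the following property with probability $1-o(n^{-3})$: if $H$ is a $(1/2+\varepsilon)$-residual subgraph of $G$ with $|H|\geq \varepsilon n$ which contains a spanning $2$-expander with at most $\delta pn^2$ edges, then $H$ is Hamiltonian.
   Context: $G(n,p)$ is the binomial random graph on $[n]$ with each edge present independently with probability $p$; asymptotics are as $n\to\infty$. $|H|=|V(H)|$. A subgraph $H$ of $G$ is $\alpha$-residual if $d_H(v)\geq \alpha\, d_{G[V(H)]}(v)$ for every $v\in V(H)$. A graph $H$ is a $2$-expander if it is connected and every $U\subset V(H)$ with $|U|\le |H|/8$ satisfies $|N(U)|\ge 2|U|$, where $N(U)$ is the set of vertices outside $U$ adjacent to some vertex of $U$. *)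

(* Defs.v *)
From HB Require Import structures.
From mathcomp Require Import all_boot all_order all_algebra.
From mathcomp Require Import boolp classical_sets reals topology normedtype.

Set Implicit Arguments.
Unset Strict Implicit.
Unset Printing Implicit Defensive.

Import Order.TTheory GRing.Theory Num.Theory.
Import numFieldNormedType.Exports.

Local Open Scope ring_scope.

Section Graphs.
Variable T : finType.
Implicit Types (x y v : T) (U V : {set T}).

Definition pairs : {set {set T}} := [set e : {set T} | #|e| == 2%N].

Definition graph_wf (VE : {set T} * {set {set T}}) : bool :=
  VE.2 \subset [set e in pairs | e \subset VE.1].

(* Finite simple graphs whose vertex set is a subset of T; an edge is an
   unordered pair of distinct vertices. *)
Record graph := Graph { graph_val : {set T} * {set {set T}};
                        _ : graph_wf graph_val }.

HB.instance Definition _ := [isSub for graph_val].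
HB.instance Definition _ := [Finite of graph by <:].

Implicit Types (G H S : graph).

Definition vertices G : {set T} := (graph_val G).1.
Definition edges G : {set {set T}} := (graph_val G).2.

Definition adj G : rel T := fun x y => [set x; y] \in edges G.

Definition degree G v : nat := #|[set w | adj G v w]|.

Definition subgraph H G : bool :=
  (vertices H \subset vertices G) && (edges H \subset edges G).

Definition spanning_subgraph S H : bool :=
  subgraph S H && (vertices S == vertices H).

Lemma induced_subproof G U :
  graph_wf (vertices G :&: U, [set e in edges G | e \subset U]).
Proof.
apply/fintype.subsetP => e; rewrite !inE /= => /andP[eG eU].
have /fintype.subsetP/(_ e eG) := valP G; rewrite !inE finset.subsetI eU.
by rewrite andbT.
Qed.

Definition induced G U : graph := Graph (induced_subproof G U).

Definition nbhd G U : {set T} :=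
  [set v in vertices G :\: U | [exists u in U, adj G u v]].

Definition graph_connected G : Prop :=
  (0 < #|vertices G|)%N /\
  {in vertices G &, forall x y, connect (adj G) x y}.

Definition two_expander G : Prop :=
  graph_connected G /\
  forall U, U \subset vertices G -> (8 * #|U| <= #|vertices G|)%N ->
    (2 * #|U| <= #|nbhd G U|)%N.

Definition hamiltonian G : Prop :=
  exists s : seq T,
    [/\ (3 <= size s)%N, ucycle (adj G) s & s =i vertices G].

Definition residual (R : realType) (alpha : R) H G : Prop :=
  forall v, v \in vertices H ->
    alpha * (degree (induced G (vertices H)) v)%:R <= (degree H v)%:R.

End Graphs.

(* Distribution of G(n, p): each of the 'C(n, 2) pairs is an edge
   independently with probability p, so a graph G with vertex set [n] has mass
   \prod_(pairs e) (p if e is an edge of G, 1 - p otherwise). *)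
Definition Gnp_mass (R : realType) (n : nat) (p : R) (G : graph 'I_n) : R :=
  \prod_(e in pairs 'I_n) (if e \in edges G then p else 1 - p).

Definition Gnp_prob (R : realType) (n : nat) (p : R)
    (A : graph 'I_n -> Prop) : R :=
  \sum_(G : graph 'I_n | (vertices G == [set: 'I_n]) && `[< A G >])
    Gnp_mass p G.

(* f = o(g) as n -> oo.  Spelled out because the little-o predicate of landau.v
   is a section-local Let, and its notation f =o_\oo g elaborates to an equation
   whose printed form hides f. *)
Definition is_littleo (R : realType) (f g : nat -> R) : Prop :=
  forall c : R, 0 < c ->
    (\forall n \near \oo, `|f n| <= c * `|g n|)%classic.

(* Main.v *)
(* Let H be non-Hamiltonian, x..y a longest path of H, and F the expander S
   together with that path: F is sparse and its longest paths are longest in H.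
   By Posa's lemma more than |H|/8 vertices x start a longest path of F, and each
   of them reaches a set B_x of more than |H|/8 endpoints.  Rotating once more
   along an edge of H at an endpoint y in B_x creates new endpoints.  If all of
   these lay in a set W of size at most (1/2 + eps/2)|H|, the residual condition
   would force G to have far too many edges between each y and the vertices
   whose successors lie in W.  Hence a constant proportion of all arcs of H leads
   out of each such W, and a greedily chosen set of O(n) arcs leads out of all
   of them, for all x simultaneously.  Adding these arcs to F gives a sparse
   K inside H in which every x above has more than (1/2 + eps/2)|H| endpoints.
   No edge of H joins x to such an endpoint, as it would close a cycle on a
   longest path of a connected graph; so the edges of H at these x go to the
   small complements, and this again contradicts the residual condition.
   The edge counts of G involved depend only on a sparse subgraph of G (F or K)
   and on O(n) further bits, so exponential moments and a union bound over
   sparse subgraphs show that all are concentrated up to eta p n^2 with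
   probability 1 - exp(-Omega(p n^2)). *)

Require Import Defs.
From mathcomp Require Import all_boot all_order all_algebra.
From mathcomp Require Import boolp reals sequences exp.
From mathcomp Require Import zify lra ring.

Set Implicit Arguments.
Unset Strict Implicit.
Unset Printing Implicit Defensive.

(** * Adjacent entries of a sequence under reversal and rotation *)

Section Consecutive.
Variable T : eqType.
Implicit Types (a b c x y z : T) (s t : seq T).

Fixpoint consecutive a b s : bool :=
  if s is c :: t then
    (if t is d :: _ then (c == a) && (d == b) || (c == b) && (d == a) else false)
    || consecutive a b t
  else false.

Lemma consecutive_cat a b s c t :
  consecutive a b (s ++ c :: t) =
  consecutive a b (rcons s c) || consecutive a b (c :: t).
Proof.
elim: s => [|d s IH] //=.
by rewrite IH orbA; case: s {IH} => [|e s] /=.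
Qed.

Lemma consecutive_rev a b s : consecutive a b (rev s) = consecutive a b s.
Proof.
elim: s => [|c s IH] //; rewrite rev_cons; case: s IH => [|d s] // IH.
rewrite rev_cons -cats1 cat_rcons consecutive_cat -rev_cons IH /=.
by rewrite !orbF orbC; congr (_ || _); rewrite orbC [(d == b) && _]andbC [(d == a) && _]andbC.
Qed.

(** Reversing the tail trades the pair of [z] and [w] for that of [z] and [last w t]; every other
    pair survives, so a vertex [a] avoiding these three sees no change. *)
Lemma consecutive_rotate a b s z w t : a \notin [:: z; w; last w t] ->
  consecutive a b (s ++ z :: rev (w :: t)) = consecutive a b (s ++ z :: w :: t).
Proof.
rewrite !inE !negb_or => /and3P[az aw ay].
rewrite consecutive_cat [in RHS]consecutive_cat; congr (_ || _).
have -> : consecutive a b (z :: w :: t) = consecutive a b (w :: t).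
  rewrite /= [z == a]eq_sym [w == a]eq_sym (negbTE az) (negbTE aw).
  by rewrite !andbF.
rewrite -[RHS]consecutive_rev.
have -> : rev (w :: t) = last w t :: behead (rev (w :: t)).
  case/lastP: t {ay} => [|t y] //=.
  by rewrite last_rcons rev_cons rev_rcons.
rewrite /= [z == a]eq_sym [last w t == a]eq_sym (negbTE az) (negbTE ay).
by rewrite !andbF.
Qed.

Lemma consecutive_split a b s : consecutive a b s ->
  exists s1 s2, s = s1 ++ a :: b :: s2 \/ s = s1 ++ b :: a :: s2.
Proof.
elim: s => [|c s IH] //=; case/orP.
  case: s {IH} => [|d s] //; case/orP => /andP[/eqP-> /eqP->]; exists [::], s; [by left|by right].
by case/IH => s1 [s2 [] ->]; exists (c :: s1), s2; [left|right].
Qed.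

Lemma next_split s z w t : uniq (s ++ z :: w :: t) ->
  next (s ++ z :: w :: t) z = w.
Proof.
move=> U; have zs : z \notin s.
  by move: U; rewrite cat_uniq => /and3P[_ /hasPn/(_ z)]; rewrite mem_head => /(_ isT).
rewrite next_nth mem_cat mem_head orbT.
case: s zs U => [|c s] zs U /=; first by rewrite eqxx.
move: zs; rewrite inE negb_or => /andP[zc zs].
rewrite [c == z]eq_sym (negbTE zc) index_cat (negbTE zs) /= eqxx addn0.
by rewrite nth_cat ltnNge leqnSn /= subSnn.
Qed.

Lemma prev_split s z w t : uniq (s ++ z :: w :: t) ->
  prev (s ++ z :: w :: t) w = z.
Proof. by move=> U; rewrite -{2}(next_split U) prev_next. Qed.

Lemma split_next x p z : uniq (x :: p) -> z \in x :: p -> z != last x p ->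
  exists s t, x :: p = s ++ z :: next (x :: p) z :: t.
Proof.
rewrite -[last x p]/(last x (x :: p)); move: (x :: p) => q U zq.
case/splitPr: zq U => s [|w t]; first by rewrite last_cat /= eqxx.
by move=> U _; rewrite next_split //; exists s, t.
Qed.

End Consecutive.

(** * Adjacency, paths and expansion *)

Section Adjacency.
Variable T : finType.
Implicit Types (G H S : graph T) (x y z u v w : T) (p q s : seq T).

Lemma adjC G x y : adj G x y = adj G y x.
Proof. by rewrite /adj setUC. Qed.

Lemma edges_wf G e : e \in edges G -> #|e| = 2 /\ e \subset vertices G.
Proof.
move=> eG; have /subsetP/(_ e eG) := valP G.
by rewrite !inE => /andP[/eqP-> ->].
Qed.

Lemma edges_pairs G : edges G \subset pairs T.
Proof. by apply/subsetP => e /edges_wf[e2 _]; rewrite inE e2. Qed.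

Lemma adj_irr G x : adj G x x = false.
Proof. by apply/negP => /edges_wf[]; rewrite setUid cards1. Qed.

Lemma adj_vertices G x y : adj G x y -> (x \in vertices G) /\ (y \in vertices G).
Proof.
by case/edges_wf => _ /subsetP sub; split; apply: sub; rewrite !inE eqxx ?orbT.
Qed.

Lemma sub_adj H G : edges H \subset edges G -> subrel (adj H) (adj G).
Proof. by move=> /subsetP sub x y; apply: sub. Qed.

Lemma adj_neq G x y : adj G x y -> x != y.
Proof. by move=> xy; apply/eqP => E; rewrite E adj_irr in xy. Qed.

(** On a fixed vertex set, extra edges only enlarge neighbourhoods. This passes expansion from [S]
    to every supergraph built later. *)
Lemma two_expander_spanning S H : spanning_subgraph S H ->
  two_expander S -> two_expander H.
Proof.
case/andP => /andP[_ sub] /eqP V [[V0 con] ex]; split; first split.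
- by rewrite -V.
- move=> x y; rewrite -V => xV yV; apply: connect_sub (con x y xV yV).
  by move=> a b /(sub_adj sub) ab; apply: connect1.
move=> U; rewrite -V => UV U8; apply: leq_trans (ex U UV U8) _.
apply/subset_leq_card/subsetP => v; rewrite !inE V => /andP[-> /existsP[u]].
by case/andP=> uU /(sub_adj sub) uv; apply/existsP; exists u; rewrite uU.
Qed.

(** * Longest paths and rotations *)

Definition gpath G x p := [&& x \in vertices G, path (adj G) x p & uniq (x :: p)].

Definition longest G x p :=
  gpath G x p /\ forall x' p', gpath G x' p' -> size p' <= size p.

Lemma gpath_size G x p : gpath G x p -> size p < #|T|.
Proof.
case/and3P => _ _ /card_uniqP E.
by rewrite -[(size p).+1]/(size (x :: p)) -E; apply: max_card.
Qed.

Lemma gpath_sub H G x p : subgraph H G -> gpath H x p -> gpath G x p.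
Proof.
case/andP => /subsetP sV sE /and3P[xV xp U]; rewrite /gpath (sV _ xV) U.
by rewrite (sub_path (sub_adj sE) xp).
Qed.

Lemma gpath_vertices G x p : gpath G x p -> {subset x :: p <= vertices G}.
Proof.
case/and3P => xV xp _ v; rewrite inE => /predU1P[-> //|].
elim: p x xV xp => //= y p IH x _ /andP[xy yp]; rewrite inE => /predU1P[->|].
  by case: (adj_vertices xy).
by apply: IH yp; case: (adj_vertices xy).
Qed.

Lemma gpath_rev G x p : gpath G x p ->
  exists q, [/\ gpath G (last x p) q, last (last x p) q = x & size q = size p].
Proof.
move=> gp; have := gp; case/and3P => xV xp U; exists (rev (belast x p)).
have E : last x p :: rev (belast x p) = rev (x :: p).
  by rewrite [in RHS]lastI rev_rcons.
split; last by rewrite size_rev size_belast.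
  apply/and3P; split; first by apply: (gpath_vertices gp); exact: mem_last.
    by rewrite rev_path; apply: sub_path xp => a b; rewrite adjC.
  by rewrite E rev_uniq.
by rewrite -[LHS]/(last (last x p) (last x p :: rev (belast x p))) E rev_cons last_rcons.
Qed.

Lemma longest_rev G x p : longest G x p ->
  exists q, longest G (last x p) q /\ last (last x p) q = x.
Proof.
case=> gp mx; case: (gpath_rev gp) => q [gq lq sq]; exists q; split=> //; split=> //.
by rewrite sq.
Qed.

Lemma longest_exists G : vertices G != set0 -> exists x p, longest G x p.
Proof.
case/set0Pn => x0 x0V.
pose P k := `[< exists x p, gpath G x p /\ size p = k >].
have P0 : exists k, P k.
  by exists 0; apply/asboolP; exists x0, [::]; rewrite /gpath x0V.
have Pb k : P k -> k <= #|T|.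
  by move=> /asboolP[x [p [/gpath_size + <-]]]; apply: ltnW.
case: (ex_maxnP P0 Pb) => k /asboolP[x [p [gp sp]]] mx.
exists x, p; split=> // x' p' gp'; rewrite sp; apply: mx.
by apply/asboolP; exists x', p'.
Qed.

(** Since [F] contains [p0], its longest paths are at least as long as [p0], and no path of [K],
    being a path of [H], is longer. *)
Lemma longest_between F K H x0 p0 : subgraph F K -> subgraph K H ->
  gpath F x0 p0 -> longest H x0 p0 -> forall x p, longest F x p -> longest K x p.
Proof.
move=> FK KH g0 [_ m0] x p [gp mp]; split; first exact: gpath_sub gp.
by move=> x' p' /(gpath_sub KH)/m0/leq_trans; apply; apply: mp g0.
Qed.

Lemma longest_nbr_mem G x p z : longest G x p -> adj G (last x p) z -> z \in x :: p.
Proof.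
case=> /and3P[xV xp U] mx yz; apply/negPn/negP => zp.
suff /mx : gpath G x (rcons p z) by rewrite size_rcons ltnn.
by rewrite /gpath xV rcons_path xp yz -rcons_cons rcons_uniq zp U.
Qed.

(** Posa's rotation: the edge [zw] gives way to the edge from the last vertex to [z], and the tail
    is traversed backwards, ending in [w]. *)
Lemma gpath_rotate G x p s z w t : gpath G x p -> x :: p = s ++ z :: w :: t ->
  adj G (last x p) z ->
  exists q, [/\ gpath G x q, x :: q = s ++ z :: rev (w :: t),
                last x q = w & size q = size p].
Proof.
move=> /and3P[xV xp U] E yz.
(* [s] may be empty, in which case [z] is [x] itself; either way the new list starts with [x]. *)
have [q Eq] : exists q, x :: q = s ++ z :: rev (w :: t).
  by exists (behead (s ++ z :: rev (w :: t))); case: s E => [|c s] [-> _].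
have Sq : size q = size p.
  have : size (x :: q) = size (x :: p).
    by rewrite Eq E !size_cat /= size_rev.
  by case.
have L : last x q = w by rewrite -[LHS]/(last x (x :: q)) Eq last_cat /= rev_cons last_rcons.
have Lp : last x p = last w t by rewrite -[LHS]/(last x (x :: p)) E last_cat.
exists q; split=> //; apply/and3P; split=> //.
- have xs r : path (adj G) x r = sorted (adj G) (x :: r) by [].
  move: xp; rewrite !xs Eq E !sorted_cat_cons.
  case/andP => -> /=; rewrite -/(sorted _ (w :: t)) => /andP[zw wt].
  have -> : rev (w :: t) = last w t :: rev (belast w t) by rewrite lastI rev_rcons.
  by rewrite /= adjC -Lp yz Lp rev_path; apply: sub_path wt => a b; rewrite adjC.
by rewrite Eq cat_uniq; move: U; rewrite E cat_uniq /= !mem_rev rev_uniq has_rev -/(uniq (w::t)).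
Qed.

Lemma longest_rotate G x p z : longest G x p -> adj G (last x p) z ->
  exists q, longest G x q /\ last x q = next (x :: p) z.
Proof.
move=> [gp mx] yz.
have zp := longest_nbr_mem (conj gp mx) yz.
have zy : z != last x p by rewrite eq_sym (adj_neq yz).
have U : uniq (x :: p) by case/and3P: gp.
case: (split_next U zp zy) => s [t E].
case: (gpath_rotate gp E yz) => q [gq _ lq sq]; exists q; split=> //.
by split=> // x' p' /mx; rewrite sq.
Qed.

(** The closing edge makes the path a cycle. An edge leaving the cycle would give a longer path, so
    by connectedness the cycle spans; [2 <= size p] provides three vertices. *)
Lemma longest_cycle_hamiltonian G x p : graph_connected G -> longest G x p ->
  2 <= size p -> adj G x (last x p) -> hamiltonian G.
Proof.
move=> [_ con] [gp mx] p2 xy; have := gp; case/and3P => xV xp U.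
have cyc : cycle (adj G) (x :: p) by rewrite /= rcons_path xp adjC.
exists (x :: p); split=> //; first by rewrite /ucycle cyc U.
(* Opening the cycle at [u] and starting from [b] instead gives a path with one more vertex. *)
have clos u b : u \in x :: p -> adj G u b -> b \in x :: p.
  move=> /rot_to[i s E] ub; apply/negPn/negP => bp.
  have [_ bV] := adj_vertices ub.
  suff /mx : gpath G b (u :: s).
    have -> : size (u :: s) = size (x :: p) by rewrite -E size_rot.
    by rewrite ltnn.
  rewrite /gpath bV cons_uniq -E mem_rot bp rot_uniq U E /= adjC ub /= andbT.
  by move: cyc; rewrite -(rot_cycle i) E /= rcons_path => /andP[].
move=> v; apply/idP/idP => [/(gpath_vertices gp) //|vV].
have /connectP[r xr ->] : connect (adj G) x v by apply: con.
elim: r {1 3 4}x (mem_head x p) xr => //= b r IH a a_in /andP[ab br].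
by apply: IH br; apply: clos ab.
Qed.

(** Every longest path from [x] counts, not only those reached by rotations, so the set depends on
    no initial path. *)
Definition ends G x : {set T} :=
  [set y | `[< exists p, longest G x p /\ last x p = y >]].

Lemma endsP G x y : reflect (exists p, longest G x p /\ last x p = y) (y \in ends G x).
Proof. by rewrite inE; apply: asboolP. Qed.

(** Posa's lemma compares each path with the fixed initial path [p0], hence the restriction to
    successive rotations of it. *)
Inductive rotation_reachable G x p0 : seq T -> Prop :=
| rotation_refl : rotation_reachable G x p0 p0
| rotation_step p q s z w t : rotation_reachable G x p0 p ->
    x :: p = s ++ z :: w :: t -> adj G (last x p) z ->
    x :: q = s ++ z :: rev (w :: t) -> rotation_reachable G x p0 q.

Definition rotation_ends G x p0 : {set T} :=
  [set y | `[< exists p, rotation_reachable G x p0 p /\ last x p = y >]].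

Lemma rotation_endsP G x p0 y :
  reflect (exists p, rotation_reachable G x p0 p /\ last x p = y)
          (y \in rotation_ends G x p0).
Proof. by rewrite inE; apply: asboolP. Qed.

Lemma last_cons_cat x p s z w t : x :: p = s ++ z :: w :: t -> last x p = last w t.
Proof. by move=> E; rewrite -[LHS]/(last x (x :: p)) E last_cat. Qed.

Lemma rotation_longest G x p0 p : longest G x p0 ->
  rotation_reachable G x p0 p -> longest G x p.
Proof.
move=> L0; elim => // {}p q s z w t _ [gp mx] E yz Eq.
case: (gpath_rotate gp E yz) => q' [gq']; rewrite -Eq => -[qq'] _ sq; rewrite -qq'.
by split=> // x' p' /mx; rewrite sq.
Qed.

(* A rotation destroys a consecutive pair only at a vertex that becomes an
   endpoint, or at its former neighbour. *)
Lemma rotation_consecutive G x p0 u : u \notin rotation_ends G x p0 ->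
  (forall b, b \in rotation_ends G x p0 -> ~~ consecutive u b (x :: p0)) ->
  forall p, rotation_reachable G x p0 p ->
  forall b, consecutive u b (x :: p) = consecutive u b (x :: p0).
Proof.
move=> uB nB p; elim => // {}p q s z w t rp IH E yz Eq b.
have rq := rotation_step rp E yz Eq.
have wB : w \in rotation_ends G x p0.
  apply/rotation_endsP; exists q; split=> //.
  by rewrite -[LHS]/(last x (x :: q)) Eq last_cat /= rev_cons last_rcons.
have yB : last w t \in rotation_ends G x p0.
  by apply/rotation_endsP; exists p; rewrite (last_cons_cat E).
rewrite Eq consecutive_rotate; first by rewrite -E IH.
rewrite !inE !negb_or; apply/and3P; split.
- apply: contraNneq (nB w wB) => uz; rewrite -IH E consecutive_cat uz /=.
  by rewrite !eqxx /= orbT.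
- by apply: contraNneq uB => ->.
- by apply: contraNneq uB => ->.
Qed.

(** Posa's lemma: a vertex outside the endpoint set but adjacent to it must be next to an endpoint
    on the initial path [p0]. *)
Lemma nbhd_rotation_ends G x p0 : longest G x p0 ->
  #|nbhd G (rotation_ends G x p0)| < 2 * #|rotation_ends G x p0|.
Proof.
move=> L0; set B := rotation_ends G x p0.
have U : uniq (x :: p0) by case: L0 => /and3P[].
have yB : last x p0 \in B.
  by apply/rotation_endsP; exists p0; split=> //; constructor.
(* The last vertex of [p0] has no successor on the path; leaving it out makes the final inequality
   strict. *)
have sub : nbhd G B \subset
    [set next (x :: p0) b | b in B :\ last x p0] :|: [set prev (x :: p0) b | b in B].
  apply/subsetP => u; rewrite !inE => /andP[/andP[uB _] /existsP[y /andP[yB' yu]]].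
  (* Otherwise [u] has the same neighbours on [p] as on [p0]. Rotating [p] along [yu] makes the
     successor of [u] an endpoint, and that successor is next to [u] on [p0]: a contradiction. *)
  have [b bB ub] : exists2 b, b \in B & consecutive u b (x :: p0).
    apply: contrapT => no.
    have nB b : b \in B -> ~~ consecutive u b (x :: p0).
      by move=> bB; apply/negP => ub; apply: no; exists b.
    have uB' : u \notin rotation_ends G x p0 by rewrite inE.
    case/rotation_endsP: yB' => p [rp lp].
    have Lp := rotation_longest L0 rp; rewrite -lp in yu.
    have up := longest_nbr_mem Lp yu.
    have Up : uniq (x :: p) by case: Lp => /and3P[].
    have uy : u != last x p by rewrite eq_sym (adj_neq yu).
    case: (split_next Up up uy) => s [t E]; set w := next _ _ in E.
    have [q [_ Eq lq _]] := gpath_rotate Lp.1 E yu.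
    have wB : w \in B.
      by apply/rotation_endsP; exists q; split=> //; apply: rotation_step rp E yu Eq.
    move: (nB w wB); rewrite -(rotation_consecutive uB' nB rp) E consecutive_cat /=.
    by rewrite !eqxx orbT.
  case/consecutive_split: ub => s1 [s2 [] E]; apply/orP.
    right; apply/imsetP; exists b => //; move: U; rewrite E => U.
    by rewrite prev_split.
  left; apply/imsetP; exists b; last by move: U; rewrite E => U; rewrite next_split.
  rewrite in_setD1 bB andbT (last_cons_cat E); move: U; rewrite E cat_uniq => /and3P[_ _].
  by rewrite cons_uniq => /andP[bn _]; apply: contraNneq bn => ->; apply: mem_last.
apply: leq_ltn_trans (subset_leq_card sub) _.
apply: leq_ltn_trans (leq_card_setU _ _) _.
have := leq_imset_card (next (x :: p0)) (mem (B :\ last x p0)).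
have := leq_imset_card (prev (x :: p0)) (mem B).
have := cardsD1 (last x p0) B; rewrite yB.
move: #|_ @: B| #|_ @: (B :\ _)| #|B :\ _| #|B| => *; lia.
Qed.

(** A set of at most an eighth of the vertices expands by a factor 2, which the rotation endpoints
    do not. *)
Lemma posa G x p : two_expander G -> longest G x p ->
  #|vertices G| < 8 * #|ends G x|.
Proof.
move=> [_ ex] L; have sB : rotation_ends G x p \subset ends G x.
  apply/subsetP => y /rotation_endsP[q [rq lq]]; apply/endsP; exists q; split=> //.
  exact: rotation_longest rq.
apply: leq_trans (_ : 8 * #|rotation_ends G x p| <= _); last first.
  by rewrite leq_mul2l subset_leq_card.
rewrite ltnNge; apply/negP => B8.
have BV : rotation_ends G x p \subset vertices G.
  apply/subsetP => y /(subsetP sB)/endsP[q [[gq _] <-]].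
  by apply: (gpath_vertices gq); apply: mem_last.
by have := nbhd_rotation_ends L; rewrite ltnNge ex.
Qed.

Definition starts G : {set T} := [set x | `[< exists p, longest G x p >]].

Lemma startsP G x : reflect (exists p, longest G x p) (x \in starts G).
Proof. by rewrite inE; apply: asboolP. Qed.

(** Reversing a longest path turns each endpoint into a start. *)
Lemma card_starts G : two_expander G -> #|vertices G| < 8 * #|starts G|.
Proof.
move=> ex; have : vertices G != set0 by rewrite -card_gt0; case: ex => -[].
case/longest_exists => x [p L]; apply: leq_trans (posa ex L) _.
rewrite leq_mul2l /=; apply/subset_leq_card/subsetP => y /endsP[q [Lq <-]].
by apply/startsP; case: (longest_rev Lq) => r [Lr _]; exists r.
Qed.

(** With at least 8 vertices, singletons are small enough to expand, so [x] has two neighbours and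
    is the middle of a path with two edges. *)
Lemma longest_size G x p : two_expander G -> 8 <= #|vertices G| ->
  longest G x p -> 2 <= size p.
Proof.
move=> [_ ex] V8 [gp mx]; have xV : x \in vertices G by case/and3P: gp.
have := ex [set x]; rewrite sub1set xV cards1 muln1 => /(_ isT V8) /card_gt1P.
case=> a [b [+ + ab]]; rewrite !inE => /andP[_ /existsP[x1]] /andP[xx1].
rewrite inE in xx1; rewrite (eqP xx1) => xa /andP[/andP[bx _]] /existsP[x2].
rewrite inE => /andP[/eqP-> xb].
apply: (mx a [:: x; b]); rewrite /gpath (adj_vertices xa).2 /= adjC xa xb !inE.
by rewrite negb_or ab [a == x]eq_sym (adj_neq xa) (adj_neq xb).
Qed.

End Adjacency.

(** * Small hitting sets *)

Lemma expn_pred_double M : 0 < M -> 2 * M.-1 ^ M <= M ^ M.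
Proof.
case: M => [|[|m]] // _; rewrite /=; set d := m.+1.
(* Bernoulli's inequality [(1 + 1/d)^k >= 1 + k/d], cleared of denominators. *)
have bern k : d ^ k * (d + k) <= d * d.+1 ^ k.
  elim: k => [|k IH]; first by rewrite !expn0; lia.
  rewrite !expnS; move: IH; set a := d ^ k; set b := d.+1 ^ k; rewrite /d; nia.
have := bern d.+1; rewrite [d ^ _]expnS; move: (d ^ d) (d.+1 ^ d.+1) => a b; rewrite /d; nia.
Qed.

Section HittingSet.
Variables (X J : finType) (O : {set X}) (C : J -> {set X}) (P : pred J) (M : nat).
Hypothesis dense : forall j, P j ->
  [/\ C j \subset O, 0 < #|C j| & #|O| <= M * #|C j|].

Let unhit (Q : {set X}) := [set j | P j & [disjoint C j & Q]].

(** Double counting of incidences: some point of [O] does at least as well as the average. *)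
Lemma dense_point (U : {set J}) : {in U, forall j, P j} -> U != set0 ->
  exists2 o, o \in O & #|U| <= M * #|[set j in U | o \in C j]|.
Proof.
move=> UP /set0Pn[j0 j0U].
have O0 : O != set0.
  case: (dense (UP _ j0U)) => /subsetP sO /card_gt0P[o /sO oO] _.
  by apply/set0Pn; exists o.
apply: contrapT => no.
have lt o : o \in O -> M * #|[set j in U | o \in C j]| < #|U|.
  by move=> oO; rewrite ltnNge; apply/negP => le; apply: no; exists o.
have : \sum_(o in O) M * #|[set j in U | o \in C j]| < \sum_(o in O) #|U|.
  case/set0Pn: O0 => o oO; rewrite (bigD1 o) //= [X in _ < X](bigD1 o) //=.
  rewrite -addSn leq_add ?lt //; apply: leq_sum => o' /andP[o'O _].
  exact: ltnW (lt _ _).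
rewrite ltnNge => /negP; apply.
rewrite -big_distrr /= sum_nat_const.
have -> : \sum_(o in O) #|[set j in U | o \in C j]| = \sum_(j in U) #|C j|.
  under eq_bigr do rewrite -sum1_card big_mkcond /=.
  rewrite exchange_big /= [RHS]big_mkcond; apply: eq_bigr => j _.
  rewrite -big_mkcondr /= -sum1_card; case: ifP => jU.
    apply: eq_bigl => o; rewrite inE jU /=.
    case: (dense (UP _ jU)) => /subsetP sO _ _.
    by apply/andP/idP => [[]//|oC]; split=> //; apply: sO.
  by rewrite big1 // => o; rewrite inE jU andbF.
rewrite big_distrr /= mulnC -sum_nat_const; apply: leq_sum => j /UP/dense[].
by [].
Qed.

(** Each greedily chosen point hits a proportion [1/M] of the sets still unhit, so after [t] points
    a proportion at most [(1 - 1/M)^t] remains. *)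
Lemma greedy_hitting t : exists Q : {set X},
  [/\ Q \subset O, #|Q| <= t & #|unhit Q| * M ^ t <= M.-1 ^ t * #|J|].
Proof.
elim: t => [|t [Q [QO Qt le]]].
  by exists set0; rewrite sub0set cards0 !expn0 muln1 mul1n max_card.
have [U0|U0] := eqVneq (unhit Q) set0.
  by exists Q; rewrite QO (leqW Qt) U0 cards0 mul0n.
have UP : {in unhit Q, forall j, P j} by move=> j; rewrite inE => /andP[].
have [o oO big] := dense_point UP U0.
exists (o |: Q); split.
- by rewrite subUset sub1set oO QO.
- by rewrite cardsU1; case: (_ \in _); lia.
have E : unhit (o |: Q) = unhit Q :\: [set j in unhit Q | o \in C j].
  apply/setP => j; rewrite !inE.
  rewrite -[[disjoint C j & o |: Q]]setI_eq0 setIUr setU_eq0 !setI_eq0.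
  rewrite [[disjoint C j & [set o]]]disjoint_sym disjoints1.
  by case: (P j); case: (o \in C j); case: [disjoint _ & _].
have := cardsD (unhit Q) [set j in unhit Q | o \in C j].
have -> : unhit Q :&: [set j in unhit Q | o \in C j] = [set j in unhit Q | o \in C j].
  by apply/setIidPr/subsetP => j; rewrite inE => /andP[].
rewrite -E => EU.
have step : #|unhit (o |: Q)| * M <= M.-1 * #|unhit Q|.
  rewrite EU; move: big; set u := #|unhit Q|; set c := #|_|; nia.
rewrite expnS mulnA; apply: leq_trans (leq_mul step (leqnn _)) _.
by rewrite -mulnA expnS -mulnA leq_mul2l le orbT.
Qed.

(** After [M * (3 * n)] greedy points the unhit proportion is at most [2^(-3n)], less than [1/#|J|],
    so no set is left. *)
Lemma hitting_set n : #|J| < 2 ^ (3 * n) -> exists Q : {set X},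
  [/\ Q \subset O, #|Q| <= M * (3 * n) & forall j, P j -> ~~ [disjoint C j & Q]].
Proof.
move=> Jn; have [Q [QO Qt le]] := greedy_hitting (M * (3 * n)).
exists Q; split=> // j Pj; apply/negP => dj.
have u0 : 0 < #|unhit Q| by apply/card_gt0P; exists j; rewrite inE Pj.
have M0 : 0 < M.
  by case: (dense Pj) => /subset_leq_card a b c; case: M c => //; lia.
have : 2 ^ (3 * n) * M.-1 ^ (M * (3 * n)) <= M ^ (M * (3 * n)).
  case: n {le Jn Qt} => [|n]; first by rewrite !muln0.
  by rewrite !(expnM _ M) -expnMn leq_exp2r ?expn_pred_double.
have : 0 < M ^ (M * (3 * n)) by rewrite expn_gt0 M0.
move: le u0 Jn; move: (M ^ _) (M.-1 ^ _) (2 ^ _) #|unhit Q| #|J| => a b c u v.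
move=> le u0 vc a0 cb; have : b * v < a.
  case: b le cb => [|b] le cb; first by rewrite mul0n.
  by apply: leq_trans cb; rewrite mulnC ltn_mul2r.
have : a <= u * a by rewrite leq_pmull.
lia.
Qed.

End HittingSet.

(** * Arcs and the deterministic argument *)

Import Order.TTheory GRing.Theory Num.Theory.

Section Arcs.
Variable T : finType.
Implicit Types (G H F K : graph T) (x y z w : T) (B V W : {set T}) (D : {set T * T}).

Definition arcs (E : {set {set T}}) D := [set ab in D | [set ab.1; ab.2] \in E].

(** Loops are never edges, so [p * #|offdiag D|] is the expected number of arcs of [D] in G(n,p). *)
Definition offdiag D := [set ab in D | ab.1 != ab.2].

Lemma card_pairs_sum (P : T -> T -> bool) B :
  #|[set ab : T * T | (ab.1 \in B) && P ab.1 ab.2]| = \sum_(a in B) #|[set b | P a b]|.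
Proof.
rewrite -sum1_card.
under [RHS]eq_bigr do rewrite -sum1_card.
rewrite pair_big_dep /=; apply: eq_big => [[a b]|//].
by rewrite !inE.
Qed.

Lemma card_setX_offdiag B V : #|B| * #|V| <= #|offdiag (setX B V)| + #|T|.
Proof.
rewrite -cardsX.
have E : setX B V = offdiag (setX B V) :|: [set ab in setX B V | ab.1 == ab.2].
  apply/setP => -[a b]; rewrite !inE /=.
  by case: (a == b); rewrite ?andbF ?andbT ?orbF.
rewrite {1}E; apply: leq_trans (leq_card_setU _ _) _; rewrite leq_add2l.
rewrite -[#|T|]cardsT -(card_imset setT (_ : injective (fun a : T => (a, a)))); last by move=> a b [].
apply/subset_leq_card/subsetP => -[a b]; rewrite !inE /= => /andP[_ /eqP->].
by apply/imsetP; exists b.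
Qed.

Lemma card_offdiag D : #|offdiag D| <= #|D|.
Proof. by apply/subset_leq_card/subsetP => ab; rewrite inE => /andP[]. Qed.

Lemma sum_degree H B : \sum_(v in B) degree H v = #|arcs (edges H) (setX B setT)|.
Proof.
rewrite -card_pairs_sum; apply: eq_card => -[a b]; rewrite !inE /= andbT.
by [].
Qed.

Lemma sum_degree_induced G V B : B \subset V ->
  \sum_(v in B) degree (induced G V) v = #|arcs (edges G) (setX B V)|.
Proof.
move=> /subsetP BV; rewrite -card_pairs_sum; apply: eq_card => -[a b].
rewrite !inE /= /adj !inE subUset !sub1set.
by case aB : (a \in B) => //=; rewrite (BV _ aB) /= andbC.
Qed.

Lemma restrict_edges_subproof H (E : {set {set T}}) :
  graph_wf (vertices H, edges H :&: E).
Proof. exact: subset_trans (subsetIl _ _) (valP H). Qed.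

Definition restrict_edges H E : graph T := Graph (restrict_edges_subproof H E).

(** A fixed choice of path makes the sets of rotations below functions of [G], [x] and [W] alone, so
    that a union bound can range over these data. *)
Definition joining_path G x y : seq T :=
  if pselect (exists p, longest G x p /\ last x p = y) is left h
  then projT1 (cid h) else [::].

Lemma joining_pathP G x y : y \in ends G x ->
  longest G x (joining_path G x y) /\ last x (joining_path G x y) = y.
Proof.
move=> /endsP h; rewrite /joining_path; case: pselect => // h'.
exact: projT2 (cid h').
Qed.

(* [(y, z)] such that rotating the chosen longest path from [x] to [y] along the
   edge [yz] produces an endpoint in [W]. *)
Definition rotations_into G x W : {set T * T} :=
  [set yz : T * T | [&& yz.1 \in ends G x, yz.2 \in x :: joining_path G x yz.1,
     yz.2 != yz.1 & next (x :: joining_path G x yz.1) yz.2 \in W]].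

(** On a path without repetitions [next] is injective, so [z] is determined by its successor in
    [W]. *)
Lemma card_rotations_into G x W : #|rotations_into G x W| <= #|ends G x| * #|W|.
Proof.
pose f (yz : T * T) := (yz.1, next (x :: joining_path G x yz.1) yz.2).
rewrite -cardsX -(card_in_imset (_ : {in rotations_into G x W &, injective f})).
  apply/subset_leq_card/subsetP => _ /imsetP[[y z] + ->].
  by rewrite !inE /= => /and4P[-> _ _ ->].
move=> [y z] [y' z']; rewrite inE /= => /and4P[yB _ _ _] _ [<-].
by case: (joining_pathP yB) => -[/and3P[_ _ U] _] _ /(can_inj (prev_next U)) ->.
Qed.

Section Real.
Variable R : realType.
Local Open Scope ring_scope.

Definition rich_starts (alpha : R) G : {set T} :=
  [set x in vertices G | alpha * #|vertices G|%:R < #|ends G x|%:R].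

(** In the final step, with a non-Hamiltonian [H], all arcs of [H] leaving a rich start of [K] fall
    into this set. *)
Definition non_ends alpha G : {set T * T} :=
  [set xw : T * T | [&& xw.1 \in rich_starts alpha G, xw.2 \in vertices G
                      & xw.2 \notin ends G xw.1]].

Lemma ends_vertices G x : ends G x \subset vertices G.
Proof.
apply/subsetP => y /endsP[q [[gq _] <-]].
by apply: (gpath_vertices gq); apply: mem_last.
Qed.

Lemma card_non_ends alpha G : #|non_ends alpha G|%:R <=
  #|rich_starts alpha G|%:R * ((1 - alpha) * #|vertices G|%:R).
Proof.
have -> : #|non_ends alpha G| =
    (\sum_(x in rich_starts alpha G) #|vertices G :\: ends G x|)%N.
  have E := card_pairs_sum (fun x w => w \in vertices G :\: ends G x) (rich_starts alpha G).
  transitivity (#|[set ab : T * T | (ab.1 \in rich_starts alpha G) &&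
      (ab.2 \in vertices G :\: ends G ab.1)]|).
    by apply: eq_card => -[a b]; rewrite !in_set /= [X in _ && X]andbC.
  by rewrite E; apply: eq_bigr => a _; apply: eq_card => b; rewrite in_set.
rewrite natr_sum mulr_natl -sumr_const; apply: ler_sum => x.
rewrite inE => /andP[_ lt].
have := cardsD (vertices G) (ends G x); rewrite (setIidPr (ends_vertices G x)).
move=> ->; rewrite natrB ?subset_leq_card ?ends_vertices //; lra.
Qed.

Definition arc_deviation (p : R) E D : R := #|arcs E D|%:R - p * #|offdiag D|%:R.

Lemma residual_sum (alpha : R) H G B : residual alpha H G -> B \subset vertices H ->
  alpha * #|arcs (edges G) (setX B (vertices H))|%:R <=
  #|arcs (edges H) (setX B setT)|%:R.
Proof.
move=> res BV; rewrite -sum_degree_induced // -sum_degree !natr_sum mulr_sumr.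
by apply: ler_sum => v vB; apply: res; apply: (subsetP BV).
Qed.

End Real.
End Arcs.

(** * From pseudorandomness to Hamiltonicity *)

Section Core.
Variables (T : finType) (R : realType).
Implicit Types (G H F K S : graph T) (B V W : {set T}) (D : {set T * T}).
Local Open Scope ring_scope.

(** All that the deterministic argument needs from G(n,p). The arc sets of the first clause depend
    on [E], but only through a subgraph with at most [k] edges, which keeps the union bound
    affordable. *)
Definition pseudorandom (alpha eta p k : R) (E : {set {set T}}) :=
  let small D := `|arc_deviation p E D| < eta * p * #|T|%:R ^+ 2 in
  (forall F, edges F \subset E -> #|edges F|%:R <= k ->
     (forall x W, small (rotations_into F x W)) /\ small (non_ends alpha F)) /\
  (forall B V, small (setX B V)).

(** The residual condition is summed over [B] and the arc count in [G] replaced by its mean. Of the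
    two error terms one is the deviation; the other pays for the loops, as
    [p * n <= eta * p * n^2]. *)
Lemma residual_arcs (eps eta p : R) H G B : 0 < eps -> 0 < p -> 0 < eta ->
  1 <= eta * #|T|%:R ->
  `|arc_deviation p (edges G) (setX B (vertices H))| < eta * p * #|T|%:R ^+ 2 ->
  residual (1 / 2 + eps) H G -> B \subset vertices H ->
  (1 / 2 + eps) * (p * (#|B|%:R * #|vertices H|%:R) - 2 * (eta * p * #|T|%:R ^+ 2)) <=
  #|arcs (edges H) (setX B setT)|%:R.
Proof.
move=> eps0 p0 eta0 n1 dev res BV.
apply: le_trans (residual_sum res BV); rewrite ler_pM2l; last by lra.
move: dev; rewrite /arc_deviation ltr_norml => /andP[lo _].
have := card_setX_offdiag B (vertices H); rewrite -(ler_nat R) natrM natrD.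
move: lo; set a := #|arcs _ _|%:R; set d := #|offdiag _|%:R; set n := #|T|%:R in n1 *.
set b := _%:R * _%:R => lo bd.
have n0 : 0 <= n by rewrite ler0n.
have : p * b <= p * (d + n) by rewrite ler_pM2l.
have : p * n <= eta * p * n ^+ 2.
  by have := ler_wpM2l (mulr_ge0 (ltW p0) n0) n1; rewrite mulr1; lra.
lra.
Qed.

(* The path edges added to [S] make a longest path of [H] available inside a
   sparse graph; the closing edge may be included as well. *)
Lemma sparse_core S H : spanning_subgraph S H ->
  forall x p, longest H x p ->
  exists F, [/\ spanning_subgraph S F, spanning_subgraph F H, gpath F x p
              & (#|edges F| <= #|edges S| + #|T|)%N].
Proof.
case/andP => /andP[SV SH] /eqP EV x p [gp _].
(* Indexing by [T] bounds the number of sets. Off the path [next] is the identity, and the resulting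
   singletons disappear on intersecting with [edges H]. *)
pose c := [set [set a; next (x :: p) a] | a : T].
exists (restrict_edges H (edges S :|: c)); split.
- rewrite /spanning_subgraph /subgraph EV subxx eqxx andbT.
  by apply/subsetP => e eS; rewrite inE (subsetP SH) // inE eS.
- by rewrite /spanning_subgraph /subgraph subxx eqxx andbT subsetIl.
- case/and3P: gp => xV xp U; rewrite /gpath xV U andbT /=.
  have : forall s q y, x :: p = s ++ y :: q -> path (adj H) y q ->
      path (adj (restrict_edges H (edges S :|: c))) y q.
    move=> s q; elim: q s => //= z q IH s y E /andP[yz zq].
    rewrite (IH (rcons s y)) ?cat_rcons // andbT /adj inE.
    apply/andP; split=> //; rewrite inE; apply/orP; right; apply/imsetP; exists y => //.
    by rewrite E next_split // -E.
  by move/(_ [::] p x); apply.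
apply: leq_trans (subset_leq_card (subsetIr _ _)) _.
apply: leq_trans (leq_card_setU _ _) _; rewrite leq_add2l.
exact: leq_trans (leq_imset_card _ _) (max_card _).
Qed.

Lemma card_index_lt : (0 < #|T|)%N -> (#|{: T * {set T}}| < 2 ^ (3 * #|T|))%N.
Proof.
move=> n0; have E : #|{set T}| = (2 ^ #|T|)%N.
  by rewrite -[in RHS]cardsT -card_powerset powersetT cardsT.
rewrite card_prod E.
have : (#|T| < 2 ^ #|T|)%N by apply: ltn_expl.
rewrite mulSn mulSn mul1n !expnD; move: (2 ^ _)%N => a; nia.
Qed.

(** Of the arcs leaving [b] vertices, [a] go into a set of mean at most [p * b * w] and [c] remain.
    The surplus [eps/2 * p * b * m] is at least [eps^3/16 * p * n^2], the errors total at most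
    [4 * eta * p * n^2], and [1/16 - 4/100 = 9/400]. *)
Lemma dense_rotations_bound (eps eta p n m b w d a c : R) :
  0 < eps <= 1 -> 0 < p -> 0 <= n -> 0 <= m -> 0 <= b -> 0 <= eta ->
  100 * eta <= eps ^+ 3 ->
  eps ^+ 3 * n ^+ 2 <= eps * m ^+ 2 -> m <= 8 * b ->
  (1 / 2 + eps) * (p * (b * m) - 2 * (eta * p * n ^+ 2)) <= c + a ->
  a < p * d + eta * p * n ^+ 2 -> d <= b * w -> w <= (1 / 2 + eps / 2) * m ->
  9 / 400 * (eps ^+ 3 * (p * n ^+ 2)) <= c.
Proof.
move=> /andP[eps0 eps1] p0 n0 m0 b0 eta0 eta_eps m3 mb lo up db wm.
have d_up : p * d <= p * (b * m) * (1 / 2 + eps / 2).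
  rewrite -mulrA ler_pM2l // -mulrA; apply: le_trans db _.
  by apply: ler_wpM2l => //; rewrite mulrC.
have N0 : 0 <= p * n ^+ 2 by rewrite mulr_ge0 ?exprn_ge0 // ltW.
have etaN : 100 * (eta * p * n ^+ 2) <= eps ^+ 3 * (p * n ^+ 2).
  by have := ler_wpM2r N0 eta_eps; rewrite !mulrA.
have eN0 : 0 <= eta * p * n ^+ 2 by rewrite -mulrA mulr_ge0.
have bm : eps ^+ 3 * (p * n ^+ 2) <= 8 * (eps * (p * (b * m))).
  have h : eps * m ^+ 2 <= 8 * (eps * (b * m)).
    by rewrite expr2 [leRHS]mulrCA ler_pM2l // mulrA ler_wpM2r.
  have := ler_wpM2l (ltW p0) (le_trans m3 h); lra.
have : eps * (eta * p * n ^+ 2) <= eta * p * n ^+ 2 by rewrite ler_piMl.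
move: lo up d_up etaN eN0 bm.
move: (eta * p * n ^+ 2) (eps ^+ 3 * (p * n ^+ 2)) (p * (b * m)) (p * d) => u v t e.
lra.
Qed.

(** The budget [k] covers the expander, [n] path edges and [3 * M * n] greedily chosen arcs. *)
Lemma residual_hamiltonian (eps eta p k : R) (M : nat) G H S :
  0 < eps -> 0 < p -> 0 < eta -> 100 * eta <= eps ^+ 3 -> eta <= 1 ->
  100 <= M%:R * eps ^+ 3 -> 1 <= eta * #|T|%:R -> 8 <= eps * #|T|%:R ->
  pseudorandom (1 / 2 + eps / 2) eta p k (edges G) ->
  #|edges S|%:R + (1 + M%:R * 3) * #|T|%:R <= k ->
  subgraph H G -> residual (1 / 2 + eps) H G -> eps * #|T|%:R <= #|vertices H|%:R ->
  spanning_subgraph S H -> two_expander S -> hamiltonian H.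
Proof.
move=> eps0 p0 eta0 eta_eps eta1 M_eps n_eta n_eps [psF psX] Sk HG res Hn SH exS.
apply: contrapT => nham.
have exH := two_expander_spanning SH exS.
set V := vertices H in Hn; set n := #|T|%:R in n_eta n_eps Hn Sk psF psX.
have n0 : 0 <= n by rewrite ler0n.
have V8 : (8 <= #|V|)%N by rewrite -(ler_nat R); apply: le_trans n_eps Hn.
have mn : #|V|%:R <= n :> R by rewrite ler_nat max_card.
have V0 : (0 < #|V|)%N by apply: leq_trans V8.
have T0 : (0 < #|T|)%N := leq_trans V0 (max_card (mem V)).
have n_gt0 : 0 < n by rewrite ltr0n.
have eps1 : eps <= 1 by rewrite -(ler_pM2r n_gt0) mul1r (le_trans Hn).
have /longest_exists[x0 [p0' L0]] : V != set0 by rewrite -card_gt0.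
have [F [SF FH gF cF]] := sparse_core SH L0.
have exF := two_expander_spanning SF exS.
case/andP: FH => FH /eqP VF.
have EHG : edges H \subset edges G by case/andP: HG.
have EFH : edges F \subset edges H by case/andP: FH.
have HH : subgraph H H by rewrite /subgraph !subxx.
have LFH := longest_between FH HH gF L0.
have pn2 : 0 < p * n ^+ 2 by rewrite mulr_gt0 // exprn_gt0.
have m2 : eps ^+ 2 * n ^+ 2 <= #|V|%:R ^+ 2.
  by rewrite -exprMn ler_pXn2r // nnegrE ?ler0n // mulr_ge0 // ltW.
have m3 : eps ^+ 3 * n ^+ 2 <= eps * #|V|%:R ^+ 2.
  by rewrite exprS -mulrA ler_pM2l.
have cFk : #|edges F|%:R <= k.
  apply: le_trans Sk; have : 0 <= M%:R * 3 * n by rewrite !mulr_ge0 ?ler0n.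
  by have := cF; rewrite -(ler_nat R) natrD -/n; lra.
have [ps1 _] := psF F (subset_trans EFH EHG) cFk.
(* [C (x, W)] consists of the arcs of [H] along which the chosen path of [F] from [x] rotates to an
   endpoint outside [W]. *)
pose O := arcs (edges H) setT.
pose C (xW : T * {set T}) : {set T * T} := [set yz : T * T |
  [&& yz.1 \in ends F xW.1, adj H yz.1 yz.2
    & next (xW.1 :: joining_path F xW.1 yz.1) yz.2 \notin xW.2]].
pose P (xW : T * {set T}) : bool := (xW.1 \in starts F) &&
  (#|xW.2|%:R <= (1 / 2 + eps / 2) * #|V|%:R :> R).
have starts_big x : x \in starts F -> #|V|%:R <= 8 * #|ends F x|%:R :> R.
  case/startsP => q Lq; rewrite -natrM ler_nat /V -VF.
  exact: ltnW (posa exF Lq).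
have dense j : P j -> [/\ C j \subset O, (0 < #|C j|)%N & (#|O| <= M * #|C j|)%N].
  case: j => x W /andP[/= xA Wm].
  (* An arc of [H] at an endpoint [y] rotates either out of [W] or into it; the latter kind is
     controlled by pseudorandomness. *)
  have sH : arcs (edges H) (setX (ends F x) setT) \subset
      C (x, W) :|: arcs (edges G) (rotations_into F x W).
    apply/subsetP => -[y z]; rewrite inE => /andP[+ yz].
    rewrite in_setX => /andP[/= yB _].
    have [Lq lq] := joining_pathP yB.
    have yz' : adj H (last x (joining_path F x y)) z by rewrite lq.
    have zq := longest_nbr_mem (LFH _ _ Lq) yz'.
    rewrite inE; apply/orP.
    case W_z : (next (x :: joining_path F x y) z \in W); [right|left].
      rewrite inE (subsetP EHG) // andbT inE /= yB zq W_z eq_sym andbT /=.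
      exact: adj_neq yz.
    by rewrite inE /= yB W_z /= andbT.
  have BV : ends F x \subset vertices H by rewrite -VF ends_vertices.
  have lo := residual_arcs eps0 p0 eta0 n_eta (psX (ends F x) V) res BV.
  have := leq_trans (subset_leq_card sH) (leq_card_setU _ _).
  rewrite -(ler_nat R) natrD => /(le_trans lo) {}lo.
  have := ps1 x W; rewrite ltr_norml /arc_deviation => /andP[_].
  rewrite ltrBlDl addrC => up.
  have up2 : #|offdiag (rotations_into F x W)|%:R <= #|ends F x|%:R * #|W|%:R :> R.
    rewrite -natrM ler_nat; apply: leq_trans (card_offdiag _) _.
    exact: card_rotations_into.
  have Cbig : 9 / 400 * (eps ^+ 3 * (p * n ^+ 2)) <= #|C (x, W)|%:R.
    apply: (dense_rotations_bound (eta := eta) (m := #|V|%:R) _ p0 n0 _ _ (ltW eta0)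
      eta_eps m3 (starts_big x xA) lo _ up2 Wm); rewrite ?ler0n ?eps0 //.
    by rewrite addrC.
  have C0 : 0 < #|C (x, W)|%:R :> R.
    by apply: lt_le_trans Cbig; rewrite !mulr_gt0 ?exprn_gt0 //; lra.
  split.
  - by apply/subsetP => -[y z]; rewrite !inE /= => /and3P[].
  - by move: C0; rewrite ltr0n.
  (* [H] has at most [2 * p * n^2] arcs in all, while [M_eps] gives [M * 9/400 * eps^3 >= 9/4]. *)
  have := psX setT setT; rewrite ltr_norml /arc_deviation => /andP[_].
  rewrite ltrBlDl => upT.
  have offT : #|offdiag (setX [set: T] [set: T])|%:R <= n ^+ 2 :> R.
    rewrite /n expr2 -natrM ler_nat; apply: leq_trans (card_offdiag _) _.
    by rewrite cardsX cardsT.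
  have OT : #|O|%:R <= #|arcs (edges G) (setX setT setT)|%:R :> R.
    rewrite ler_nat; apply/subset_leq_card/subsetP => -[a b].
    by rewrite !inE /= => /(subsetP EHG).
  have MC := ler_wpM2l (ler0n R M) Cbig.
  have MN := ler_wpM2r (ltW pn2) M_eps.
  have e1 := ler_wpM2r (ltW pn2) eta1.
  have pT := ler_wpM2l (ltW p0) offT.
  rewrite -(ler_nat R) natrM; apply: le_trans OT _; apply: le_trans MC.
  move: upT pT e1 MN; rewrite !mulrA; lra.
have [Q [QO cQ hit]] := hitting_set dense (card_index_lt T0).
pose K := restrict_edges H (edges F :|: [set [set ab.1; ab.2] | ab in Q]).
have KH : subgraph K H by rewrite /subgraph subxx subsetIl.
have FK : subgraph F K.
  rewrite /subgraph VF subxx /=; apply/subsetP => e eF.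
  by rewrite inE (subsetP EFH) // inE eF.
have cK : #|edges K|%:R <= k.
  apply: le_trans Sk.
  have : (#|edges K| <= #|edges S| + #|T| + M * (3 * #|T|))%N.
    apply: leq_trans (subset_leq_card (subsetIr _ _)) _.
    apply: leq_trans (leq_card_setU _ _) _; apply: leq_add => //.
    exact: leq_trans (leq_imset_card _ _) cQ.
  by rewrite -(ler_nat R) !natrD !natrM -/n; lra.
have LFK := longest_between FK KH gF L0.
have LKH : forall x q, longest K x q -> longest H x q.
  by apply: longest_between KH HH (gpath_sub FK gF) L0.
have [_ ps2] := psF K (subset_trans (subsetIl _ _) EHG) cK.
set alpha := 1 / 2 + eps / 2 in ps2 P dense hit.
(* If [ends K x] were small, [Q] would contain an arc rotating out of it. That arc is an edge of
   [K], so the new endpoint lies in [ends K x] after all. *)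
have sub : starts F \subset rich_starts alpha K.
  apply/subsetP => x xA; rewrite inE; apply/andP; split.
    by case/startsP: xA => q [/and3P[+ _ _] _]; rewrite VF.
  rewrite ltNge; apply/negP => le.
  have /hit : P (x, ends K x) by rewrite /P /= xA.
  rewrite -setI_eq0 => /set0Pn[[y z]]; rewrite inE => /andP[yzC yzQ].
  move: yzC; rewrite inE /= => /and3P[yB yz /negP]; apply.
  have [Lq lq] := joining_pathP yB.
  have yzK : adj K (last x (joining_path F x y)) z.
    rewrite lq /adj !inE; apply/andP; split=> //; apply/orP; right.
    by apply/imsetP; exists (y, z).
  by apply/endsP; apply: longest_rotate (LFK _ _ Lq) yzK.
(* An edge of [H] from [x] to an end of [x] would close a longest path of [H] into a Hamilton
   cycle. *)
have no_end : arcs (edges H) (setX (rich_starts alpha K) setT)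
    \subset arcs (edges G) (non_ends alpha K).
  apply/subsetP => -[x w]; rewrite inE => /andP[+ xw].
  rewrite in_setX => /andP[/= xR _].
  rewrite inE (subsetP EHG) // andbT inE /= xR (adj_vertices xw).2 /=.
  apply/negP => /endsP[q [/LKH Lq lq]]; apply: nham.
  apply: (longest_cycle_hamiltonian exH.1 Lq); first exact: longest_size Lq.
  by rewrite lq.
set A := rich_starts alpha K in sub no_end.
have AV : A \subset vertices H by apply/subsetP => x; rewrite inE => /andP[].
have lo := residual_arcs eps0 p0 eta0 n_eta (psX A V) res AV.
have := subset_leq_card no_end; rewrite -(ler_nat R) => /(le_trans lo) {}lo.
move: ps2; rewrite ltr_norml /arc_deviation => /andP[_].
rewrite ltrBlDl => up.
have up2 : #|offdiag (non_ends alpha K)|%:R <= #|A|%:R * ((1 - alpha) * #|V|%:R).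
  by apply: le_trans (card_non_ends alpha K); rewrite ler_nat card_offdiag.
have A8 : #|V|%:R <= 8 * #|A|%:R :> R.
  rewrite -natrM ler_nat /V -VF; apply: leq_trans (ltnW (card_starts exF)) _.
  by rewrite leq_mul2l subset_leq_card.
(* The same estimate with no arcs remaining, [c = 0], is the contradiction. *)
have : 9 / 400 * (eps ^+ 3 * (p * n ^+ 2)) <= 0.
  apply: (dense_rotations_bound (eta := eta) (m := #|V|%:R) _ p0 n0 _ _ (ltW eta0)
      eta_eps m3 A8 (c := 0) _ up up2); rewrite ?ler0n ?eps0 ?add0r //.
  have : 0 <= eps * #|V|%:R by rewrite mulr_ge0 ?ler0n // ltW.
  by rewrite /alpha; lra.
apply/negP; rewrite -ltNge !mulr_gt0 ?exprn_gt0 //; lra.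
Qed.

End Core.

(** * Concentration of arc counts *)

Local Open Scope ring_scope.

(** Expanding the right-hand product, the zero second summand on [B] kills all terms with [B] not
    inside [E]. *)
Lemma sum_subsets_prod (R : comPzRingType) (I : finType) (A B : {set I}) (a b : I -> R) :
  B \subset A ->
  \sum_(E : {set I} | (E \subset A) && (B \subset E))
     \prod_(i in A) (if i \in E then a i else b i) =
  \prod_(i in A) (a i + (if i \in B then 0 else b i)).
Proof.
move=> BA; rewrite [RHS]big_mkcond /=.
pose f i := if i \in A then a i else 0.
pose h i := if i \in A then (if i \in B then 0 else b i) else 1.
rewrite [RHS](eq_bigr (fun i => f i + h i)); last first.
  by move=> i _; rewrite /f /h; case: ifP => //; rewrite add0r.
rewrite bigA_distr big_mkcond /=; apply: eq_bigr => E _.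
case: ifP => [/andP[EA BE]|/negbT bad].
  rewrite big_mkcond /=; apply: eq_bigr => i _; rewrite /f /h.
  case iE : (i \in E); first by rewrite (subsetP EA).
  case: ifP => // _; case: ifP => // iB.
  by rewrite (subsetP BE) in iE.
symmetry; move: bad; rewrite negb_and => /orP[] /subsetPn[i i1 i2].
  by rewrite (bigD1 i) //= i1 /f (negbTE i2) mul0r.
by rewrite (bigD1 i) //= (negbTE i2) /h i1 (subsetP BA) // mul0r.
Qed.

Lemma sum_subsets_exp (R : comPzRingType) (I : finType) (A : {set I}) (c : R) :
  \sum_(E : {set I} | E \subset A) c ^+ #|E| = (1 + c) ^+ #|A|.
Proof.
have -> : (1 + c) ^+ #|A| = \prod_(i in A) (c + (if i \in set0 then 0 else 1)).
  by rewrite -prodr_const; apply: eq_bigr => i _; rewrite inE addrC.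
rewrite -(sum_subsets_prod (fun=> c) (fun=> 1) (sub0set A)).
apply: eq_big => [E|E EA]; first by rewrite sub0set andbT.
rewrite -prodr_const -big_mkcondr /=; apply: eq_bigl => i.
by apply/idP/andP => [iE|[]//]; split=> //; apply: (subsetP EA).
Qed.

Section Moments.
Variables (R : realType) (T : finType).
Implicit Types (E : {set {set T}}) (D : {set T * T}) (p : R).

Definition edge_mass p E : R := \prod_(e in pairs T) (if e \in E then p else 1 - p).

Lemma edge_mass_ge0 p E : 0 <= p <= 1 -> 0 <= edge_mass p E.
Proof.
by move=> /andP[p0 p1]; apply: prodr_ge0 => e _; case: ifP => // _; rewrite subr_ge0.
Qed.

Lemma sum_edge_mass p : \sum_(E : {set {set T}} | E \subset pairs T) edge_mass p E = 1.
Proof.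
have := sum_subsets_prod (fun=> p) (fun=> 1 - p) (sub0set (pairs T)).
rewrite [RHS]big1 => [<-|e _]; last by rewrite inE addrC subrK.
by apply: eq_bigl => E; rewrite sub0set andbT.
Qed.

Lemma sum_supersets p (g : {set T} -> R) E' : E' \subset pairs T ->
  \sum_(E : {set {set T}} | (E \subset pairs T) && (E' \subset E))
     edge_mass p E * \prod_(e in E) g e =
  \prod_(e in pairs T) (p * g e + (if e \in E' then 0 else 1 - p)).
Proof.
move=> E'P; rewrite -sum_subsets_prod //; apply: eq_bigr => E /andP[EP _].
have -> : \prod_(e in E) g e = \prod_(e in pairs T) (if e \in E then g e else 1).
  rewrite -big_mkcondr /=; apply: eq_bigl => e.
  by apply/idP/andP => [eE|[]//]; split=> //; apply: (subsetP EP).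
by rewrite -big_split; apply: eq_bigr => e _ /=; case: ifP; rewrite ?mulr1.
Qed.

(** The number of orientations of [e] in [D]. Arc counts become sums of independent edge indicators
    with weights at most 2. *)
Definition multiplicity D (e : {set T}) := #|[set ab in D | [set ab.1; ab.2] == e]|.

Lemma card_arcs_sum E D : #|arcs E D| = (\sum_(e in E) multiplicity D e)%N.
Proof.
rewrite -sum1_card (partition_big (fun ab : T * T => [set ab.1; ab.2]) (mem E)) /=.
  apply: eq_bigr => e eE; rewrite /multiplicity -sum1_card; apply: eq_bigl => ab.
  by rewrite !inE; case: eqP => [->|]; rewrite ?eE ?andbF // !andbT.
by move=> ab; rewrite inE => /andP[].
Qed.

Lemma card_offdiag_sum D : #|offdiag D| = (\sum_(e in pairs T) multiplicity D e)%N.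
Proof.
rewrite -card_arcs_sum; apply: eq_card => -[a b]; rewrite !inE cards2 /=.
by case: (a == b).
Qed.

Lemma multiplicity_le2 D e : e \in pairs T -> (multiplicity D e <= 2)%N.
Proof.
rewrite inE => /cards2P[a [b [_ ->]]].
apply: leq_trans (_ : #|[set (a, b); (b, a)]| <= 2)%N; last first.
  by rewrite cards2; case: (_ != _).
apply/subset_leq_card/subsetP => -[u v]; rewrite !inE /= => /andP[_ /eqP E].
have : u \in [set a; b] by rewrite -E !inE eqxx.
have : v \in [set a; b] by rewrite -E !inE eqxx orbT.
have : a \in [set u; v] by rewrite E !inE eqxx.
have : b \in [set u; v] by rewrite E !inE eqxx orbT.
rewrite !inE !xpair_eqE.
by do 4!(case/orP => /eqP ?); subst; rewrite ?eqxx ?orbT.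
Qed.

Lemma card_pairs_le : (#|pairs T| <= #|T| ^ 2)%N.
Proof.
rewrite expnS expn1 -card_prod.
have sub : pairs T \subset [set [set ab.1; ab.2] | ab : T * T].
  apply/subsetP => e; rewrite inE => /cards2P[a [b [_ ->]]].
  by apply/imsetP; exists (a, b).
apply: leq_trans (subset_leq_card sub) _.
exact: leq_trans (leq_imset_card _ _) (max_card _).
Qed.

Lemma card_offdiag_le D : (#|offdiag D| <= #|T| ^ 2)%N.
Proof. by apply: leq_trans (max_card _) _; rewrite card_prod expnS expn1. Qed.

(** From [expR (- x) >= 1 - x], since [(1 + x + 2x^2)(1 - x) = 1 + x^2(1 - 2x)]. *)
Lemma expR_le_quadratic (x : R) : x <= 1 / 2 -> expR x <= 1 + x + 2 * x ^+ 2.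
Proof.
move=> x2; have pos : 0 < 1 - x by lra.
have le : expR x <= (1 - x)^-1.
  rewrite -[x in leLHS]opprK expRN lef_pV2 ?posrE ?expR_gt0 //.
  by have := expR_ge1Dx (- x).
apply: le_trans le _; rewrite -div1r ler_pdivrMr //.
have : 0 <= x ^+ 2 * (1 - 2 * x) by rewrite mulr_ge0 ?sqr_ge0 //; lra.
lra.
Qed.

Lemma edge_moment p theta (d : nat) : 0 <= p <= 1 -> `|theta| <= 1 / 4 -> (d <= 2)%N ->
  p * expR (theta * d%:R) + (1 - p) <= expR (p * (theta + 4 * theta ^+ 2) * d%:R).
Proof.
move=> /andP[p0 p1] th d2; move: th; rewrite ler_norml => /andP[thl thu].
have d2' : d%:R <= 2 :> R by rewrite ler_nat.
have d0 : 0 <= d%:R :> R by rewrite ler0n.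
apply: le_trans (expR_ge1Dx _).
have h : expR (theta * d%:R) <= 1 + theta * d%:R + 4 * theta ^+ 2 * d%:R.
  apply: le_trans (expR_le_quadratic _) _; first by nra.
  rewrite lerD2l exprMn; have : 0 <= theta ^+ 2 by apply: sqr_ge0.
  have dd : d%:R ^+ 2 <= 2 * d%:R :> R by rewrite expr2 ler_wpM2r.
  by move=> /ler_wpM2l/(_ _ _ dd); lra.
have := ler_wpM2l p0 h; lra.
Qed.

(** The factor of an unforced pair is kept, so that the product runs uniformly over all pairs; the
    excess [(1 - p) * theta * d] is at most [2 * lam]. *)
Lemma edge_moment_forced p theta lam (d : nat) : 0 <= p <= 1 -> `|theta| <= lam ->
  (d <= 2)%N ->
  p * expR (theta * d%:R) <=
  p * expR (2 * lam) * expR (p * (theta + 4 * theta ^+ 2) * d%:R).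
Proof.
move=> /andP[p0 p1] th d2; move: th; rewrite ler_norml => /andP[thl thu].
have d2' : d%:R <= 2 :> R by rewrite ler_nat.
have d0 : 0 <= d%:R :> R by rewrite ler0n.
rewrite -mulrA ler_wpM2l // -expRD ler_expR.
have : 0 <= p * (4 * theta ^+ 2) * d%:R.
  by apply: mulr_ge0 => //; apply: mulr_ge0 => //; have := sqr_ge0 theta; lra.
have pd0 : 0 <= p * d%:R by apply: mulr_ge0.
have c0 : 0 <= (1 - p) * d%:R by apply: mulr_ge0 => //; lra.
have := ler_wpM2l c0 thu.
have : (1 - p) * d%:R * lam <= 2 * lam by apply: ler_wpM2r; lra.
lra.
Qed.

(** As [D] stays fixed while [E] varies, the moment factorises over pairs, and each forced edge
    costs [p * expR (2 * lam)]. *)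
Lemma moment_supersets p theta lam E' D : 0 <= p <= 1 -> `|theta| <= lam -> lam <= 1 / 4 ->
  E' \subset pairs T ->
  \sum_(E : {set {set T}} | (E \subset pairs T) && (E' \subset E))
     edge_mass p E * expR (theta * #|arcs E D|%:R) <=
  (p * expR (2 * lam)) ^+ #|E'| * expR (p * (theta + 4 * theta ^+ 2) * #|offdiag D|%:R).
Proof.
move=> p01 th lam4 E'P.
rewrite (eq_bigr (fun E => edge_mass p E *
    \prod_(e in E) expR (theta * (multiplicity D e)%:R))); last first.
  by move=> E _; rewrite card_arcs_sum natr_sum mulr_sumr expR_sum.
rewrite sum_supersets // card_offdiag_sum natr_sum mulr_sumr expR_sum -prodr_const.
have -> : \prod_(e in E') (p * expR (2 * lam)) =
    \prod_(e in pairs T) (if e \in E' then p * expR (2 * lam) else 1).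
  rewrite -big_mkcondr /=; apply: eq_bigl => e.
  by apply/idP/andP => [eE'|[]//]; split=> //; apply: (subsetP E'P).
rewrite -big_split /=; apply: ler_prod => e eP.
have d2 := multiplicity_le2 D eP; case/andP: (p01) => p0 p1.
rewrite addr_ge0 ?mulr_ge0 ?expR_ge0 //=; last by case: ifP => // _; lra.
case: ifP => _; first by rewrite addr0; apply: edge_moment_forced.
by rewrite mul1r; apply: edge_moment => //; apply: le_trans lam4.
Qed.

(** After exchanging the sums, [D E'] is fixed for each [E']. The weight
    [expR (sigma * (k - #|E'|))] replaces the restriction [#|E'| <= k], so the sum over [E'] is a
    full binomial expansion. *)
Lemma deviation_moment (eta lam sigma k p theta : R)
    (D : {set {set T}} -> {set T * T}) :
  0 <= p <= 1 -> 0 <= eta <= 1 -> lam = eta / 8 -> `|theta| = lam ->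
  expR (2 * lam - sigma) <= eta ^+ 2 / 64 ->
  sigma * k <= eta ^+ 2 / 64 * (p * #|T|%:R ^+ 2) ->
  \sum_(E : {set {set T}} | E \subset pairs T)
    \sum_(E' : {set {set T}} | E' \subset E)
      edge_mass p E * expR (sigma * (k - #|E'|%:R) +
        theta * arc_deviation p E (D E') - lam * (eta * p * #|T|%:R ^+ 2)) <=
  expR (- (eta ^+ 2 / 32 * (p * #|T|%:R ^+ 2))).
Proof.
move=> p01 /andP[eta0 eta1] lamE thE sig sigk; case/andP: (p01) => p0 p1.
set n2 := #|T|%:R ^+ 2 in sigk *; have n20 : 0 <= n2 by rewrite exprn_ge0 ?ler0n.
have pn0 : 0 <= p * n2 by rewrite mulr_ge0.
have th2 : theta ^+ 2 = eta ^+ 2 / 64.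
  by rewrite -real_normK ?num_real // thE lamE expr_div_n; congr (_ / _); lra.
rewrite (exchange_big_dep (fun E' : {set {set T}} => E' \subset pairs T)) /=; last first.
  by move=> E E' EP E'E; apply: subset_trans EP.
set c := p * expR (2 * lam - sigma).
have c0 : 0 <= c by rewrite mulr_ge0 ?expR_ge0.
(* With [lam = eta/8], the variance term [4 * theta^2] is [eta^2/16] and the threshold term
   [lam * eta] is [eta^2/8]. *)
pose K := expR (sigma * k + eta ^+ 2 / 16 * (p * n2) - eta ^+ 2 / 8 * (p * n2)).
apply: (@le_trans _ _ (\sum_(E' : {set {set T}} | E' \subset pairs T) K * c ^+ #|E'|)).
  apply: ler_sum => E' E'P; set N : R := #|offdiag (D E')|%:R.
  have -> : \sum_(E : {set {set T}} | (E \subset pairs T) && (E' \subset E))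
      edge_mass p E * expR (sigma * (k - #|E'|%:R) +
        theta * arc_deviation p E (D E') - lam * (eta * p * n2)) =
      expR (sigma * (k - #|E'|%:R) - theta * p * N - lam * (eta * p * n2)) *
      \sum_(E : {set {set T}} | (E \subset pairs T) && (E' \subset E))
        edge_mass p E * expR (theta * #|arcs E (D E')|%:R).
    rewrite mulr_sumr; apply: eq_bigr => E _; rewrite [RHS]mulrCA -expRD; congr (_ * expR _).
    by rewrite /arc_deviation -/N; ring.
  apply: le_trans (ler_wpM2l (expR_ge0 _)
    (moment_supersets (D E') (lam := lam) p01 _ _ E'P)) _; [by rewrite thE|by lra|].
  have -> : c ^+ #|E'| = (p * expR (2 * lam)) ^+ #|E'| * expR (- sigma * #|E'|%:R).
    by rewrite (expRM_natr #|E'|) -exprMn /c expRD mulrA.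
  rewrite mulrCA [leRHS]mulrCA ler_wpM2l ?exprn_ge0 ?mulr_ge0 ?expR_ge0 //.
  rewrite -!expRD ler_expR th2.
  have Nn : p * N <= p * n2.
    by rewrite ler_wpM2l // /N /n2 -natrX ler_nat card_offdiag_le.
  have : 0 <= eta ^+ 2 by apply: sqr_ge0.
  move=> /ler_wpM2l/(_ _ _ Nn); rewrite lamE -/N; lra.
rewrite -mulr_sumr sum_subsets_exp.
apply: (@le_trans _ _ (K * expR (c * n2))).
  rewrite ler_wpM2l ?expR_ge0 //.
  apply: (@le_trans _ _ (expR c ^+ #|pairs T|)).
    by rewrite lerXn2r ?nnegrE ?expR_ge0 ?addr_ge0 ?expR_ge1Dx.
  rewrite -expRM_natr ler_expR ler_wpM2l // /n2 -natrX ler_nat; exact: card_pairs_le.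
(* In units of [eta^2 * p * n^2] the exponent is at most [1/64 + 1/16 - 1/8 + 1/64 = -1/32]. *)
rewrite -expRD ler_expR.
have : c * n2 <= eta ^+ 2 / 64 * (p * n2).
  by have := ler_wpM2r pn0 sig; rewrite /c; lra.
lra.
Qed.

(** Markov's inequality for both signs of [theta], whence the factor 2. *)
Lemma deviation_union_bound (I : finType) (eta sigma k p : R)
    (D : {set {set T}} -> I -> {set T * T}) :
  0 <= p <= 1 -> 0 <= eta <= 1 -> 0 <= sigma ->
  expR (eta / 4 - sigma) <= eta ^+ 2 / 64 ->
  sigma * k <= eta ^+ 2 / 64 * (p * #|T|%:R ^+ 2) ->
  \sum_(E : {set {set T}} | (E \subset pairs T) &&
      [exists E' : {set {set T}}, exists i : I, [&& E' \subset E, #|E'|%:R <= k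
        & eta * p * #|T|%:R ^+ 2 <= `|arc_deviation p E (D E' i)|]]) edge_mass p E <=
  2 * #|I|%:R * expR (- (eta ^+ 2 / 32 * (p * #|T|%:R ^+ 2))).
Proof.
move=> p01 eta01 sigma0 sig sigk.
pose lam := eta / 8; have lam0 : 0 <= lam by rewrite /lam; case/andP: eta01; lra.
pose w theta E E' i := edge_mass p E * expR (sigma * (k - #|E'|%:R) +
  theta * arc_deviation p E (D E' i) - lam * (eta * p * #|T|%:R ^+ 2)).
have w0 theta E E' i : 0 <= w theta E E' i.
  by rewrite mulr_ge0 ?edge_mass_ge0 ?expR_ge0.
pose s theta := \sum_(i : I) \sum_(E : {set {set T}} | E \subset pairs T)
  \sum_(E' : {set {set T}} | E' \subset E) w theta E E' i.
have s_le theta : `|theta| = lam ->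
    s theta <= #|I|%:R * expR (- (eta ^+ 2 / 32 * (p * #|T|%:R ^+ 2))).
  move=> th; rewrite mulr_natl -sumr_const; apply: ler_sum => i _.
  apply: (deviation_moment (fun E' => D E' i) p01 eta01 erefl th _ sigk).
  by apply: le_trans sig; rewrite ler_expR /lam; lra.
apply: (@le_trans _ _ (s lam + s (- lam))); last first.
  have := s_le lam; have := s_le (- lam); rewrite normrN ger0_norm // => /(_ erefl) a /(_ erefl).
  lra.
rewrite /s -big_split /= -/lam.
rewrite (eq_bigr (fun i => \sum_(E : {set {set T}} | E \subset pairs T)
  (\sum_(E' : {set {set T}} | E' \subset E) (w lam E E' i + w (- lam) E E' i)))); last first.
  by move=> i _; rewrite -big_split; apply: eq_bigr => E _; rewrite -big_split.
rewrite exchange_big /= big_mkcondr /=; apply: ler_sum => E EP.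
case: ifP => [/existsP[E' /existsP[i /and3P[E'E kE' dev]]]|_]; last first.
  by apply: sumr_ge0 => i _; apply: sumr_ge0 => E' _; rewrite addr_ge0.
rewrite (bigD1 i) //= (bigD1 E') //= -addrA ler_wpDr //.
  rewrite addr_ge0 // ?sumr_ge0 // => [E'' _|j _]; first by rewrite addr_ge0.
  by apply: sumr_ge0 => E'' _; rewrite addr_ge0.
have m0 := edge_mass_ge0 E p01.
have k0 : 0 <= sigma * (k - #|E'|%:R) by rewrite mulr_ge0 // subr_ge0.
(* The sign of the deviation decides which of the two weights at the witness is at least the mass of
   [E]. *)
have [dpos|dneg] := leP 0 (arc_deviation p E (D E' i)).
  apply: ler_wpDr => //; rewrite ler_peMr // -[leLHS]expR0 ler_expR.
  rewrite ger0_norm // in dev; have := ler_wpM2l lam0 dev; lra.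
apply: le_trans (_ : w (- lam) E E' i <= _); last by rewrite lerDr.
rewrite ler_peMr // -[leLHS]expR0 ler_expR.
rewrite ltr0_norm // in dev; have := ler_wpM2l lam0 dev; lra.
Qed.

End Moments.

(** * Tests for pseudorandomness, and G(n,p) through its edge sets *)

Section RandomGraph.
Variables (R : realType) (T : finType).
Implicit Types (G F : graph T) (V W : {set T}) (E : {set {set T}}).

Lemma graph_on_subproof V E : graph_wf (V, [set e in pairs T | e \subset V] :&: E).
Proof. exact: subsetIl. Qed.

Definition graph_on V E : graph T := Graph (graph_on_subproof V E).

Lemma graph_on_vertices G : graph_on (vertices G) (edges G) = G.
Proof.
apply: val_inj => /=; rewrite (setIidPr (valP G : edges G \subset _)).
by rewrite /vertices /edges; case: (graph_val G).
Qed.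

Lemma edges_graph_onT E : E \subset pairs T -> edges (graph_on setT E) = E.
Proof.
move=> EP; apply/setIidPr/subsetP => e /(subsetP EP).
by rewrite !inE subsetT andbT.
Qed.

(* The tests [option bool] select the three kinds of arc sets that
   [pseudorandom] controls. *)
Definition test_arcs (alpha : R) E (i : option bool * {set T} * {set T} * T) : {set T * T} :=
  let: (c, V, W, x) := i in
  match c with
  | None => setX V W
  | Some true => rotations_into (graph_on V E) x W
  | Some false => non_ends alpha (graph_on V E)
  end.

(** A graph [F] is recovered from its edge set, which serves as [E'], and its vertex set, which is
    part of the test index. *)
Lemma pseudorandom_tests (alpha eta p k : R) E : (0 < #|T|)%N -> 0 <= k ->
  ~~ [exists E' : {set {set T}}, exists i, [&& E' \subset E, #|E'|%:R <= k
        & eta * p * #|T|%:R ^+ 2 <= `|arc_deviation p E (test_arcs alpha E' i)|]] ->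
  pseudorandom alpha eta p k E.
Proof.
move=> /card_gt0P[x0 _] k0 nbad.
have small E' i : E' \subset E -> #|E'|%:R <= k ->
    `|arc_deviation p E (test_arcs alpha E' i)| < eta * p * #|T|%:R ^+ 2.
  move=> E'E kE'; rewrite ltNge; apply: contra nbad => dev.
  by apply/existsP; exists E'; apply/existsP; exists i; rewrite E'E kE'.
split=> [F FE kF|B V].
  split=> [x W|].
    have := small (edges F) (Some true, vertices F, W, x) FE kF.
    by rewrite /= graph_on_vertices.
  have := small (edges F) (Some false, vertices F, set0, x0) FE kF.
  by rewrite /= graph_on_vertices.
by apply: (small set0 (None, B, V, x0)); rewrite ?sub0set ?cards0.
Qed.

(** The left side is [6 * 2^n * 2^n * n], where [6 <= expR (3 * n)] and each other factor is at most
    [expR n]. *)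
Lemma card_tests : (0 < #|T|)%N ->
  2 * #|{: option bool * {set T} * {set T} * T}|%:R <= expR (6 * #|T|%:R) :> R.
Proof.
move=> T0; have cs : #|{set T}| = (2 ^ #|T|)%N.
  by rewrite -[in RHS]cardsT -card_powerset powersetT cardsT.
rewrite !card_prod card_option card_bool cs !natrM natrX.
set n := #|T|; have n1 : 1 <= n%:R :> R by rewrite ler1n.
have e2 : 2 <= expR 1 :> R by have := expR_ge1Dx (1 : R); lra.
have en : n%:R <= expR n%:R :> R by have := expR_ge1Dx (n%:R : R); lra.
have e2n : 2 ^+ n <= expR n%:R :> R.
  by rewrite -[n%:R]mulr1 expRM_natl lerXn2r ?nnegrE ?expR_ge0.
have e6 : 6 <= expR (3 * n%:R) :> R.
  apply: le_trans (_ : expR 3 <= _); last by rewrite ler_expR; lra.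
  rewrite -[3 in leRHS]mulr1 expRM_natl; apply: le_trans (_ : 2 ^+ 3 <= _).
    by rewrite -natrX ler_nat.
  by rewrite lerXn2r ?nnegrE ?expR_ge0.
have -> : expR (6 * n%:R) = expR (3 * n%:R) * (expR n%:R * expR n%:R * expR n%:R) :> R.
  by rewrite -!expRD; congr expR; ring.
have -> : 2 * (3 * 2 ^+ n * 2 ^+ n * n%:R) = 6 * (2 ^+ n * 2 ^+ n * n%:R) :> R by ring.
by rewrite !ler_pM ?mulr_ge0 ?exprn_ge0.
Qed.

End RandomGraph.

Lemma Gnp_prob_compl (R : realType) n (p : R) (A : graph 'I_n -> Prop) :
  1 - Gnp_prob p A =
  \sum_(E : {set {set 'I_n}} | (E \subset pairs 'I_n) && ~~ `[< A (graph_on setT E) >])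
     edge_mass p E.
Proof.
have -> : Gnp_prob p A =
    \sum_(E : {set {set 'I_n}} | (E \subset pairs 'I_n) && `[< A (graph_on setT E) >])
     edge_mass p E.
  rewrite /Gnp_prob (reindex_onto (graph_on setT) (@edges 'I_n)) /=; last first.
    by move=> G /andP[/eqP VG _]; rewrite -{1}VG graph_on_vertices.
  apply: eq_big => [E|E /andP[_ /eqP]].
    rewrite eqxx /= andbC; congr (_ && _).
    apply/eqP/idP => [<-|/edges_graph_onT //]; exact: edges_pairs.
  by rewrite /Gnp_mass => ->.
rewrite -(sum_edge_mass 'I_n p).
rewrite (bigID (fun E => `[< A (graph_on setT E) >])) /= addrC addrK.
by [].
Qed.

Lemma Gnp_prob_compl_le (R : realType) n (p : R) (A : graph 'I_n -> Prop)
    (bad : pred {set {set 'I_n}}) : 0 <= p <= 1 ->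
  (forall E : {set {set 'I_n}}, E \subset pairs 'I_n -> ~~ bad E -> A (graph_on setT E)) ->
  `|1 - Gnp_prob p A| <=
  \sum_(E : {set {set 'I_n}} | (E \subset pairs 'I_n) && bad E) edge_mass p E.
Proof.
move=> p01 good; rewrite Gnp_prob_compl ger0_norm; last first.
  by apply: sumr_ge0 => E _; apply: edge_mass_ge0.
rewrite [leRHS](bigID (fun E => `[< A (graph_on setT E) >])) /= ler_wpDl //.
  by apply: sumr_ge0 => E _; apply: edge_mass_ge0.
rewrite le_eqVlt; apply/orP; left; apply/eqP; apply: eq_bigl => E.
case EP : (E \subset pairs 'I_n) => //=.
case bE : (bad E) => //=; apply/negbTE; rewrite negbK; apply/asboolP.
by apply: good; rewrite ?bE.
Qed.

From mathcomp Require Import classical_sets topology normedtype.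
Import numFieldNormedType.Exports.
Local Open Scope classical_set_scope.

Theorem theorem1p6 (R : realType) (eps : R) (eps_gt0 : 0 < eps) :
  exists delta C : R, [/\ 0 < delta, 0 < C &
    forall p : nat -> R,
      (forall n, 0 <= p n <= 1) ->
      (\forall n \near \oo, C / n%:R <= p n) ->
      is_littleo
        (fun n => 1 - Gnp_prob (p n) (fun G : graph 'I_n =>
           forall H : graph 'I_n,
             subgraph H G ->
             residual (1 / 2 + eps) H G ->
             eps * n%:R <= #|vertices H|%:R ->
             (exists S : graph 'I_n,
                [/\ spanning_subgraph S H, two_expander S &
                    #|edges S|%:R <= delta * p n * n%:R ^+ 2]) ->
             hamiltonian H))
        (fun n => n%:R ^- 3)].
Proof.
pose eta : R := Num.min 1 (eps ^+ 3 / 100).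
have eps3 : 0 < eps ^+ 3 by rewrite exprn_gt0.
have eta0 : 0 < eta by rewrite lt_min ltr01 divr_gt0.
have eta1 : eta <= 1 by rewrite ge_min lexx.
have eta_eps : 100 * eta <= eps ^+ 3.
  have : eta <= eps ^+ 3 / 100 by rewrite ge_min lexx orbT.
  lra.
have eta20 : 0 < eta ^+ 2 by rewrite exprn_gt0.
have eta21 : eta ^+ 2 <= 1 by rewrite expr_le1 // ltW.
(* The price per edge of the sparse subgraph, chosen to make [expR (eta / 4 - sigma)] equal to
   [eta^2 / 64]. *)
pose sigma : R := eta / 4 + ln (64 / eta ^+ 2).
have sigma0 : 0 < sigma.
  rewrite ltr_wpDr ?divr_gt0 // ln_ge0 // ler_pdivlMr //; lra.
have sig : expR (eta / 4 - sigma) <= eta ^+ 2 / 64.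
  by rewrite opprD addrA subrr sub0r -lnV ?posrE ?divr_gt0 // lnK ?posrE ?invr_gt0 ?divr_gt0 // invf_div.
(* With [k = delta * p * n^2] this gives [sigma * k = eta^2 / 64 * p * n^2]. *)
pose delta : R := eta ^+ 2 / 64 / sigma.
have delta0 : 0 < delta by rewrite !divr_gt0.
pose M := Num.bound (100 / eps ^+ 3).
have M_eps : 100 <= M%:R * eps ^+ 3.
  by rewrite -ler_pdivrMr // ltW // archi_boundP // divr_ge0 // ltW.
(* [C1] makes [eta^2 / 32 * p * n^2] at least [10 * n], of which the tests take [6 * n]. [C2] fits
   the added edges into half of [k]; the expander has the other half, hence [delta / 2]. *)
pose C1 : R := 320 / eta ^+ 2; pose C2 : R := 2 * (1 + M%:R * 3) / delta.
have C10 : 0 < C1 by rewrite divr_gt0.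
have C20 : 0 < C2 by rewrite divr_gt0 // mulr_gt0 // ltr_pwDl // mulr_ge0 ?ler0n.
exists (delta / 2), (C1 + C2); split; [by rewrite divr_gt0|by rewrite addr_gt0|].
move=> p p01 pC c c0.
near=> n.
have nC : (C1 + C2) / n%:R <= p n by near: n.
have n_eta : 1 <= eta * n%:R.
  by rewrite -ler_pdivrMl // mulr1; near: n; apply: nbhs_infty_ger.
have n_eps : 8 <= eps * n%:R.
  by rewrite -ler_pdivrMl //; near: n; apply: nbhs_infty_ger.
have n_c : c^-1 <= n%:R by near: n; apply: nbhs_infty_ger.
have n0 : 0 < n%:R :> R.
  by rewrite -(pmulr_rgt0 _ eta0); apply: lt_le_trans n_eta.
have T0 : (0 < #|'I_n|)%N by rewrite card_ord -(ltr0n R).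
set q := p n in nC *; have q01 : 0 <= q <= 1 := p01 n.
have qn : (C1 + C2) * n%:R <= q * n%:R ^+ 2.
  by move: nC; rewrite ler_pdivrMr // => /(ler_wpM2r (ltW n0)); rewrite expr2 mulrA.
have q0 : 0 < q by apply: lt_le_trans nC; rewrite divr_gt0 // addr_gt0.
have qn0 : 0 < q * n%:R ^+ 2 by rewrite mulr_gt0 // exprn_gt0.
pose k := delta * (q * n%:R ^+ 2).
have k0 : 0 <= k by rewrite mulr_ge0 ?ltW.
pose alpha : R := 1 / 2 + eps / 2.
pose bad (E : {set {set 'I_n}}) := [exists E' : {set {set 'I_n}}, exists i,
  [&& E' \subset E, #|E'|%:R <= k & eta * q * #|'I_n|%:R ^+ 2 <=
     `|arc_deviation q E (test_arcs alpha E' i)|]].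
apply: (le_trans (Gnp_prob_compl_le (bad := bad) q01 _)).
  move=> E EP /(pseudorandom_tests T0 k0) ps H HG res Hn [S [SH exS Sd]].
  apply: (residual_hamiltonian eps_gt0 q0 eta0 eta_eps eta1 M_eps (k := k) _ _ _ _ HG res _ SH exS);
    rewrite ?card_ord ?edges_graph_onT //.
  have C2n : C2 * n%:R <= q * n%:R ^+ 2.
    by apply: le_trans qn; rewrite ler_pM2r // lerDr ltW.
  have dC2 : delta * C2 = 2 * (1 + M%:R * 3) by rewrite mulrC divfK ?gt_eqF.
  have := ler_wpM2l (ltW delta0) C2n; rewrite mulrA dC2 /k; lra.
apply: (le_trans (deviation_union_bound (sigma := sigma) _ q01 _ (ltW sigma0) sig _)).
- by rewrite eta1 ltW.
- by rewrite card_ord /k /delta mulrCA mulrA divfK ?gt_eqF // mulrC.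
have cc := card_tests R T0; rewrite card_ord in cc *.
apply: (@le_trans _ _ (expR (- (4 * n%:R)))).
  apply: le_trans (ler_wpM2r (expR_ge0 _) cc) _; rewrite -expRD ler_expR.
  have C1n : C1 * n%:R <= q * n%:R ^+ 2.
    by apply: le_trans qn; rewrite ler_pM2r // lerDl ltW.
  have eC1 : eta ^+ 2 * C1 = 320 by rewrite mulrC divfK ?gt_eqF.
  have h := ler_wpM2l (ltW eta20) C1n; rewrite mulrA eC1 in h.
  lra.
(* [n <= expR n] bounds the probability by [n^(-4)], and [n >= 1/c] turns one factor into [c]. *)
rewrite expRN -[4]/(4%:R) expRM_natl normfV ger0_norm ?exprn_ge0 ?ler0n //.
have en : n%:R <= expR n%:R :> R by have := expR_ge1Dx (n%:R : R); lra.
apply: (@le_trans _ _ (n%:R ^+ 4)^-1).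
  by rewrite lef_pV2 ?posrE ?exprn_gt0 ?expR_gt0 // lerXn2r ?nnegrE ?expR_ge0 ?ler0n.
rewrite exprS invfM ler_wpM2r ?invr_ge0 ?exprn_ge0 ?ler0n //.
by rewrite -[c]invrK lef_pV2 ?posrE ?invr_gt0.
Unshelve. all: by end_near.
Qed.
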